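(* For any integer $k\geq 1$ there is a triangle-free graph with treedepth $\binom{k+1}{2}$ and chromatic number at least $k$.
   Context: Graphs are finite, simple and undirected; chromatic number is the usual (proper) chromatic number. In a rooted tree, the depth of a vertex $v$ is the number of vertices on the path from the root to $v$; the depth of a rooted forest is the maximum depth of its vertices; the closure of a rooted forest $F$ is the graph on $V(F)$ in which two distinct vertices are adjacent if and only if one is an ancestor of the other. The treedepth of a graph $G$ is the minimum depth of a rooted forest $F$ such that $G$ is a spanning subgraph of the closure of $F$. *)

(* Defs.v *)
From mathcomp Require Import all_boot.

Set Implicit Arguments.
Unset Strict Implicit.
Unset Printing Implicit Defensive.

Record sgraph := SGraph {
  vert :> finType;
  adj : rel vert;
  adj_sym : symmetric adj;
  adj_irr : irreflexive adj
}.

Definition triangle_free (G : sgraph) : Prop :=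
  ~ exists x y z : G, [/\ adj x y, adj y z & adj x z].

Definition proper_coloring (G : sgraph) (n : nat) (c : {ffun G -> 'I_n}) : bool :=
  [forall x, forall y, adj x y ==> (c x != c y)].

Definition colorable (G : sgraph) (n : nat) : bool :=
  [exists c : {ffun G -> 'I_n}, proper_coloring c].

Lemma ex_colorable (G : sgraph) : exists n, colorable G n.
Proof.
exists #|G|; apply/existsP; exists [ffun x => enum_rank x].
apply/forallP=> x; apply/forallP=> y; apply/implyP=> xy; rewrite !ffunE.
by apply/eqP=> /enum_rank_inj eq_xy; rewrite eq_xy adj_irr in xy.
Qed.

Definition chromatic_number (G : sgraph) : nat := ex_minn (ex_colorable G).

(* A rooted forest with vertex set T is given by its parent map: p v = None  *)
(* when v is a root, and p v = Some u when u is the parent of v.  A map      *)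
(* T -> option T arises in this way iff following parents never closes up    *)
(* into a cycle.                                                             *)
Definition parent_rel (T : finType) (p : {ffun T -> option T}) : rel T :=
  fun u v => p u == Some v.

Definition acyclic (T : finType) (p : {ffun T -> option T}) : bool :=
  [forall u, forall v, parent_rel p u v ==> ~~ connect (parent_rel p) v u].

Definition rforest (T : finType) := {p : {ffun T -> option T} | acyclic p}.

(* Reflexive: every vertex is an ancestor of itself. *)
Definition ancestor (T : finType) (F : rforest T) (u v : T) : bool :=
  connect (parent_rel (val F)) v u.

(* The vertices on the path from the root to v are the ancestors of v,       *)
(* v included; in particular roots have depth 1.                             *)
Definition vdepth (T : finType) (F : rforest T) (v : T) : nat :=
  #|[set u | ancestor F u v]|.

Definition fdepth (T : finType) (F : rforest T) : nat := \max_(v : T) vdepth F v.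

Definition closure_adj (T : finType) (F : rforest T) : rel T :=
  fun u v => (u != v) && (ancestor F u v || ancestor F v u).

(* F has the same vertex set as G, so G is a spanning subgraph of the        *)
(* closure of F as soon as its edges are edges of the closure.               *)
Definition spanning_sub_closure (G : sgraph) (F : rforest G) : bool :=
  [forall x, forall y, adj x y ==> closure_adj F x y].

Definition has_forest_of_depth (G : sgraph) (d : nat) : bool :=
  [exists F : rforest G, spanning_sub_closure F && (fdepth F == d)].

Lemma ex_forest_of_depth (G : sgraph) : exists d, has_forest_of_depth G d.
Proof.
pose p : {ffun G -> option G} :=
  [ffun v => [pick u | (enum_rank u).+1 == enum_rank v :> nat]].
have pE u v : parent_rel p u v = ((enum_rank v).+1 == enum_rank u :> nat).
  rewrite /parent_rel ffunE; case: pickP => [w /eqP rw|nw]; last by rewrite nw.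
  apply/eqP/eqP => [[<-] //|rv]; congr Some; apply/enum_rank_inj/val_inj.
  by apply: succn_inj; rewrite rw rv.
have dec v u : connect (parent_rel p) v u -> enum_rank u <= enum_rank v.
  case/connectP=> s + ->; elim: s v => [|w s IHs] v //= /andP[].
  rewrite pE => /eqP rw /IHs ru; exact: leq_trans ru (ltnW (eq_leq rw)).
have acp : acyclic p.
  apply/forallP=> u; apply/forallP=> v; apply/implyP; rewrite pE => /eqP ruv.
  by apply/negP=> /dec; rewrite -ruv ltnn.
have up n u v : enum_rank v = n + enum_rank u :> nat -> connect (parent_rel p) v u.
  elim: n v => [|n IHn] v rv.
    by rewrite (enum_rank_inj (val_inj rv)) connect0.
  have lt_n : n + enum_rank u < #|G| by rewrite -addSn -rv ltnW.
  apply: (@connect_trans _ _ (enum_val (Ordinal lt_n))); last first.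
    by apply: IHn; rewrite enum_valK.
  by apply: connect1; rewrite pE enum_valK /= rv addSn.
exists (fdepth (exist _ p acp : rforest G)); apply/existsP.
exists (exist _ p acp : rforest G); rewrite eqxx andbT.
apply/forallP=> x; apply/forallP=> y; apply/implyP=> xy; apply/andP; split.
  by apply/eqP=> eq_xy; rewrite eq_xy adj_irr in xy.
by case/orP: (leq_total (enum_rank x) (enum_rank y)) => /subnK/esym/up;
  rewrite /ancestor /= => ->; rewrite ?orbT.
Qed.

Definition treedepth (G : sgraph) : nat := ex_minn (ex_forest_of_depth G).

(* Main.v *)
Require Import Defs.
From mathcomp Require Import all_boot.

(* Consider the game in which a presenter reveals vertices one at a time and a
   painter properly colours each of them.  The tree of all histories of the
   game, each position being joined to those earlier positions on its branch
   that the presenter makes it adjacent to, has treedepth at most the length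
   of the game, and a proper colouring of it is a strategy for the painter.

   The presenter keeps an independent set A with distinct colours and an
   independent set X whose colours are distinct and all occur in A, the
   neighbours of X being vertices of A whose colours occur in X. A new
   vertex is joined to the vertices of A whose colours occur in X, so its
   colour is not in X; as the neighbours are independent, no triangle
   arises.  If the colour occurs in A, the vertex is added to X. Otherwise
   the vertex, X and the vertices of A whose colours do not occur in X form
   an independent set with |A| + 1 colours, which replaces A. Enlarging A
   takes at most |A| + 1 vertices, whence k colours within 1 + 2 + ... + k
   vertices. *)

Set Implicit Arguments.
Unset Strict Implicit.
Unset Printing Implicit Defensive.

(** * Upper and lower bounds on treedepth *)

Lemma connect_parentE (T : finType) (p : {ffun T -> option T}) (v u : T) :
  connect (parent_rel p) v u =
    (v == u) || (if p v is Some w then connect (parent_rel p) w u else false).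
Proof.
apply/idP/idP => [/connectP[[|w s] /= + ->] | /orP[/eqP-> | ]].
- by rewrite eqxx.
- case/andP=> /eqP-> ws; apply/orP; right; by apply/connectP; exists s.
- exact: connect0.
case pv: (p v) => [w|//]; apply: connect_trans; apply: connect1.
exact/eqP.
Qed.

(** The rank [r] strictly drops towards the root, so [p] has no cycle and a vertex [v] has at most
    [(r v).+1] ancestors. *)
Lemma treedepth_le (G : sgraph) (p : {ffun G -> option G}) (r : G -> nat)
    (d : nat) :
    (forall u v, p u = Some v -> r v < r u) ->
    (forall u, r u < d) ->
    (forall x y : G, adj x y ->
      connect (parent_rel p) x y || connect (parent_rel p) y x) ->
  treedepth G <= d.
Proof.
move=> pr rd Gp.
have dec v u : connect (parent_rel p) v u -> r u <= r v.
  case/connectP=> s + ->; elim: s v => [|w s IHs] v //= /andP[/eqP/pr vw].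
  by move=> /IHs /leq_trans; apply; apply: ltnW.
have acp : acyclic p.
  apply/forallP=> u; apply/forallP=> v; apply/implyP=> /eqP /pr vu.
  by apply/negP=> /dec; rewrite leqNgt vu.
pose F : rforest G := exist _ p acp.
have dF m v : r v < m -> vdepth F v <= m.
  elim: m v => // m IHm v; rewrite ltnS => vm.
  have := eq_refl (p v); case: {2}(p v) => [w|] /eqP pv.
    have /subset_leq_card le : [set u | ancestor F u v]
        \subset v |: [set u | ancestor F u w].
      by apply/subsetP=> u; rewrite !inE /ancestor connect_parentE pv eq_sym.
    apply: leq_trans le _; rewrite cardsU1 -[m.+1]add1n leq_add ?leq_b1 //.
    exact: IHm (leq_trans (pr _ _ pv) vm).
  rewrite /vdepth (_ : [set u | _] = [set v]) ?cards1 //.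
  by apply/setP=> u; rewrite !inE /ancestor connect_parentE pv orbF eq_sym.
rewrite /treedepth; case: ex_minnP => m _ min_m.
apply: (@leq_trans (fdepth F)); last by apply/bigmax_leqP=> v _; apply: dF.
apply: min_m; apply/existsP; exists F; rewrite eqxx andbT.
apply/forallP=> x; apply/forallP=> y; apply/implyP=> xy; apply/andP; split.
  by apply: contraTneq xy => ->; rewrite adj_irr.
by rewrite orbC; apply: Gp.
Qed.

Lemma ancestor_anti (T : finType) (F : rforest T) (u v : T) :
  ancestor F u v -> ancestor F v u -> u = v.
Proof.
rewrite {1}/ancestor connect_parentE; case/orP=> [/eqP-> //|].
case: F => p acp /=; case pv: (p v) => [w|//] wu uv.
have /forallP/(_ v)/forallP/(_ w) := acp.
by rewrite /parent_rel pv eqxx (connect_trans wu uv).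
Qed.

(* A deepest vertex of S in the forest has all its neighbours in S among its
   ancestors. *)
Lemma treedepth_gt_min_degree (G : sgraph) (S : {set G}) (v0 : G) (d : nat) :
    v0 \in S ->
    (forall v, v \in S -> d <= #|[set w in S | adj v w]|) ->
  d < treedepth G.
Proof.
move=> v0S degS; rewrite /treedepth; case: ex_minnP => m /existsP[F].
case/andP=> /forallP GF /eqP <- _.
case: (arg_maxnP (vdepth F) v0S) => v vS v_max.
apply: leq_trans (leq_bigmax v); rewrite /vdepth (cardsD1 v) inE.
rewrite {1}/ancestor connect0 add1n ltnS; apply: leq_trans (degS v vS) _.
apply/subset_leq_card/subsetP=> w; rewrite !inE => /andP[wS vw].
have /forallP/(_ w)/implyP/(_ vw)/andP[v'w] := GF v.
rewrite eq_sym v'w orbC => /orP[-> //|anc_vw].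
have := v_max w wS; rewrite /= leqNgt => /negP[]; apply: proper_card.
apply/properP; split.
  by apply/subsetP=> u; rewrite !inE /ancestor; apply: connect_trans.
exists w; rewrite !inE; first exact: connect0.
by apply: contraNN v'w => /(ancestor_anti anc_vw) ->.
Qed.

(** * The game and its states *)

(* A history lists, most recent first, the colours given to the vertices
   presented so far; it also names the vertex presented next.  In a state
   [(A, X)] both components list vertices together with their colours. *)
Definition game_nbrs (C : eqType) (st : seq (seq C * C) * seq (seq C * C)) :=
  [seq p.1 | p <- st.1 & p.2 \in unzip2 st.2].

(** A vertex is the history before its own colouring, so prepending [c] to [g] colours the vertex
    [g]; hence the entries [(g, c)]. *)
Fixpoint game_state (C : eqType) (h : seq C)
    : seq (seq C * C) * seq (seq C * C) :=
  if h is c :: g then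
    let: (A, X) := game_state g in
    if c \in unzip2 A then (A, (g, c) :: X)
    else ((g, c) :: X ++ [seq p <- A | p.2 \notin unzip2 X], [::])
  else ([::], [::]).

Definition game_rel (C : eqType) : rel (seq C) :=
  fun g h => g \in game_nbrs (game_state h).

Lemma game_state_suffix (C : eqType) (h : seq C) (p : seq C * C) :
  p \in (game_state h).1 ++ (game_state h).2 ->
  suffix p.1 h && (size p.1 < size h).
Proof.
elim: h p => [|c g IH] p //=; case: (game_state g) IH => A X /= IH.
have ext q : q \in A ++ X -> suffix q.1 (c :: g) && (size q.1 < (size g).+1).
  by case/IH/andP=> s l; rewrite ltnW // andbT -cat1s suffix_catr.
have new : suffix g (c :: g) && (size g < (size g).+1).
  by rewrite ltnSn andbT -cat1s suffix_suffix.
case: ifP => _ /=.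
  rewrite mem_cat inE orbCA => /orP[/eqP-> //|pAX].
  by apply: ext; rewrite mem_cat.
rewrite cats0 inE mem_cat mem_filter => /or3P[/eqP-> // | pX | /andP[_ pA]].
  by apply: ext; rewrite mem_cat pX orbT.
by apply: ext; rewrite mem_cat pA.
Qed.

Lemma game_rel_suffix (C : eqType) (g h : seq C) :
  game_rel g h -> suffix g h && (size g < size h).
Proof.
case/mapP=> p; rewrite mem_filter => /andP[_ pA] ->.
by apply: game_state_suffix; rewrite mem_cat pA.
Qed.

Lemma uniq_map_in_inj (S T : eqType) (f : S -> T) (s : seq S) :
  uniq [seq f x | x <- s] -> {in s &, injective f}.
Proof.
move=> U x y xs ys e; suff idx z : z \in s -> index (f z) (map f s) = index z s.
  by rewrite -(nth_index x xs) -(idx x xs) e (idx y ys) nth_index.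
move=> zs; rewrite -{1}(nth_index z zs) -(nth_map _ (f z)) ?index_mem //.
by rewrite index_uniq // size_map index_mem.
Qed.

(** The vertex [g] is longer than all those stored before it. Distinctness lets an entry be
    recovered from its vertex alone. *)
Lemma game_state_uniq (C : eqType) (h : seq C) :
  uniq (unzip1 ((game_state h).1 ++ (game_state h).2)).
Proof.
elim: h => [|c g IH] //=.
have new : g \notin unzip1 ((game_state g).1 ++ (game_state g).2).
  by apply/mapP=> -[p /game_state_suffix/andP[_ +] gp]; rewrite -gp ltnn.
case: (game_state g) IH new => A X /= IH new; case: ifP => _ /=.
  rewrite (perm_uniq (_ : perm_eq _ (g :: unzip1 (A ++ X)))) /= ?new //.
  by rewrite /unzip1 !map_cat /= perm_catC /= perm_cons perm_catC.
have sub : subseq (unzip1 (X ++ [seq p <- A | p.2 \notin unzip2 X]))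
                  (unzip1 (X ++ A)).
  by apply: map_subseq; apply: cat_subseq; rewrite ?filter_subseq.
have eqm : perm_eq (unzip1 (X ++ A)) (unzip1 (A ++ X)).
  by apply: perm_map; rewrite perm_catC.
rewrite cats0; apply/andP; split; last first.
  by apply: subseq_uniq sub _; rewrite (perm_uniq eqm).
by apply: contraNN new => /(mem_subseq sub); rewrite (perm_mem eqm).
Qed.

Definition game_indep (C : eqType) (s : seq (seq C * C)) : Prop :=
  forall p q, p \in s -> q \in s -> ~~ game_rel p.1 q.1.

(** Independence of [A] alone is not inductive: once [X] is merged into [A], edges between the two
    must be excluded. The last two clauses do so, as the vertices of [A] that meet [X] have colours
    in [X] and are dropped. *)
Lemma game_state_indep (C : eqType) (h : seq C) :
  let: (A, X) := game_state h in
  [/\ game_indep A, game_indep X,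
      forall p x, p \in A -> x \in X -> ~~ game_rel x.1 p.1 &
      forall p x, p \in A -> x \in X -> game_rel p.1 x.1 -> p.2 \in unzip2 X].
Proof.
elim: h => [|c g IH] /=; first by split.
have U := game_state_uniq g.
have SS := @game_state_suffix _ g.
have gE q : game_rel q g = (q \in game_nbrs (game_state g)) by [].
case: (game_state g) U SS gE IH => A X /= U SS gE [II IX IXI IIX].
have notg q : q \in A ++ X -> ~~ game_rel g q.1.
  case/SS/andP=> _ ltq; apply/negP => /game_rel_suffix/andP[_].
  by move/(ltn_trans ltq); rewrite ltnn.
have gg : ~~ game_rel g g.
  by apply/negP => /game_rel_suffix/andP[_]; rewrite ltnn.
have fstP := uniq_map_in_inj U.
have nX x : x \in X -> ~~ game_rel x.1 g.
  move=> xX; rewrite gE; apply/mapP=> -[p]; rewrite mem_filter => /andP[_ pA] e.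
  move: U; rewrite /unzip1 map_cat cat_uniq => /and3P[_ /hasPn dAX _].
  by have /negP[] := dAX _ (map_f fst xX); rewrite /= e map_f.
have nI p : p \in A -> game_rel p.1 g -> p.2 \in unzip2 X.
  move=> pA; rewrite gE => /mapP[q]; rewrite mem_filter => /andP[qX qA] e.
  by rewrite (fstP p q) // mem_cat ?pA ?qA.
have inI p : p \in A -> p \in A ++ X by rewrite mem_cat => ->.
have inX p : p \in X -> p \in A ++ X by rewrite mem_cat orbC => ->.
case: ifP => _; split => //=.
- move=> p q; rewrite !inE => /predU1P[->|pX] /predU1P[->|qX] //=.
  + exact/notg/inX.
  + exact: nX.
  + exact: IX.
- move=> p x pA /predU1P[->|xX]; [exact/notg/inI | exact: IXI].
- move=> p x pA /predU1P[->|xX] px; rewrite inE.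
    by rewrite (nI p pA px) orbT.
  by rewrite (IIX p x pA xX px) orbT.
move=> p q; rewrite !inE !mem_cat !mem_filter.
case/or3P=> [/eqP-> | pX | /andP[pX pA]];
  case/or3P=> [/eqP-> | qX | /andP[qX qA]] //=.
- exact/notg/inX.
- exact/notg/inI.
- exact: nX.
- exact: IX.
- exact: IXI.
- exact: contraNN (nI _ pA) pX.
- exact: contraNN (IIX _ _ pA qX) pX.
- exact: II.
Qed.

Lemma game_rel_triangle_free (C : eqType) (f g h : seq C) :
  game_rel f h -> game_rel g h -> ~~ game_rel f g.
Proof.
rewrite /game_rel => /mapP[p + ->] /mapP[q + ->].
have := game_state_indep h; case: (game_state h) => A X /= [II _ _ _].
by rewrite !mem_filter => /andP[_ pA] /andP[_ qA]; apply: II.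
Qed.

(** * Counting colours along a play *)

Fixpoint play (C : eqType) (f : seq C -> C) (t : nat) : seq C :=
  if t is t'.+1 then f (play f t') :: play f t' else [::].

Lemma size_play (C : eqType) (f : seq C -> C) (t : nat) : size (play f t) = t.
Proof. by elim: t => //= t ->. Qed.

(** Enlarging [A] from size [a] costs at most [a + 1] rounds, which sum to the binomial; [size X]
    counts the rounds since the last enlargement. *)
Lemma play_state (C : eqType) (f : seq C -> C) (d : nat) :
    (forall g h, size h < d -> game_rel g h -> f g != f h) ->
  forall t, t <= d ->
  let: (A, X) := game_state (play f t) in
  [/\ {in A ++ X, forall p, p.2 = f p.1}, uniq (unzip2 A), uniq (unzip2 X),
      {subset unzip2 X <= unzip2 A} & t <= 'C((size A).+1, 2) + size X].
Proof.
move=> f_proper; elim=> [|t IH] //= lt_td.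
have := IH (ltnW lt_td); move: (f_proper^~ (play f t)).
rewrite size_play => /(_ _ lt_td); rewrite /game_rel.
case: (game_state _) => A X /= prop [fE UI UX sXI le_t].
set h := play f t in prop *.
have fhX : f h \notin unzip2 X.
  apply/negP=> fX; have /mapP[p pA fp] := sXI _ fX.
  have /prop : p.1 \in game_nbrs (A, X).
    by rewrite /game_nbrs map_f // mem_filter -fp pA fX.
  by rewrite fp fE ?eqxx // mem_cat pA.
case: ifP => fI; split => //=.
- move=> p; rewrite mem_cat inE orbCA => /predU1P[-> //|pAX].
  by apply: fE; rewrite mem_cat.
- by rewrite fhX.
- by move=> c /predU1P[->|/sXI].
- by rewrite addnS ltnS.
- move=> p; rewrite cats0 inE mem_cat mem_filter.
  case/or3P=> [/eqP-> //|pX|/andP[_ pA]]; apply: fE;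
    by rewrite mem_cat ?pX ?pA ?orbT.
- rewrite {1}/unzip2 map_cat mem_cat negb_or fhX /=; apply/andP; split.
    apply: contraFN fI => /mapP[p]; rewrite mem_filter => /andP[_ pA] ->.
    exact: map_f.
  rewrite /unzip2 map_cat cat_uniq UX /=; apply/andP; split.
    by apply/hasPn=> c /mapP[p]; rewrite mem_filter => /andP[pX _] ->.
  by apply: subseq_uniq UI; apply: map_subseq; apply: filter_subseq.
rewrite addn0 size_cat.
(* Each colour of [X] occurs exactly once in [A], so exchanging the dropped vertices for [X]
   preserves the size. *)
have sz : size X + size [seq p <- A | p.2 \notin unzip2 X] = size A.
  rewrite size_filter -(count_predC (fun p => p.2 \in unzip2 X) A); congr addn.
  rewrite -(count_map snd) -size_filter -(size_map snd X).
  apply/perm_size; apply: uniq_perm; rewrite ?filter_uniq // => c.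
  by rewrite mem_filter andb_idr //; apply: sXI.
rewrite sz binS bin1 addnS ltnS; apply: leq_trans le_t _.
by rewrite leq_add2l -sz leq_addr.
Qed.

Lemma game_rel_colors (C : eqType) (f : seq C -> C) (k : nat) :
    (forall g h, size h < 'C(k.+1, 2) -> game_rel g h -> f g != f h) ->
  exists s : seq (seq C), k <= size s /\ uniq [seq f h | h <- s].
Proof.
move=> f_proper; have := play_state f_proper (leqnn _).
case: (game_state _) => A X /= [fE UI UX sXI le_k]; exists (unzip1 A).
have -> : [seq f h | h <- unzip1 A] = unzip2 A.
  rewrite -map_comp; apply/eq_in_map => p pA.
  by rewrite fE // mem_cat pA.
split=> //; rewrite size_map leqNgt; apply/negP=> lt_Ik.
have leX : size X <= size A.
  by rewrite -(size_map snd X) -(size_map snd A); apply: uniq_leq_size.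
(* With [a = size A < k], at most ['C(a.+1, 2) + a] rounds have passed, one fewer than
   ['C(a.+2, 2)]. *)
have : 'C((size A).+2, 2) <= 'C(k.+1, 2) by apply: leq_bin2l.
move/leq_trans/(_ le_k); rewrite binS bin1 leq_add2l.
by move/leq_trans/(_ leX); rewrite ltnn.
Qed.

(** * The finite graph of histories *)

(* The [true] copy joins every leaf of the tree of histories to all of its
   proper ancestors; its only purpose is to keep the treedepth from being
   smaller than the height of the tree. *)
Definition history_rel (n : nat) (C : eqType) (b : bool) : rel (seq C) :=
  fun g h =>
    if b then [&& suffix g h, size g < n & size h == n] else game_rel g h.

Lemma history_rel_suffix (n : nat) (C : eqType) (b : bool) (g h : seq C) :
  history_rel n b g h -> suffix g h && (size g < size h).
Proof.
case: b; last exact: game_rel_suffix.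
by case/and3P=> -> lt_gn /eqP->.
Qed.

(** In the [true] copy, later endpoints have length [n] and earlier ones less, so no vertex is
    both. *)
Lemma history_rel_triangle_free (n : nat) (C : eqType) (b : bool)
    (f g h : seq C) :
  history_rel n b f h -> history_rel n b g h -> ~~ history_rel n b f g.
Proof.
case: b => /=; last exact: game_rel_triangle_free.
move=> _ /and3P[_ lt_gn _]; apply/negP=> /and3P[_ _ /eqP gn].
by rewrite gn ltnn in lt_gn.
Qed.

Definition history_adj (n : nat) (C : finType) : rel (bool * {bseq n of C}) :=
  fun x y => (x.1 == y.1) &&
    (history_rel n x.1 x.2 y.2 || history_rel n x.1 y.2 x.2).

Lemma history_adj_sym (n : nat) (C : finType) : symmetric (@history_adj n C).
Proof.
move=> [b g] [b' h]; rewrite /history_adj eq_sym /=.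
by case: eqP => //= ->; rewrite orbC.
Qed.

Lemma history_adj_irr (n : nat) (C : finType) : irreflexive (@history_adj n C).
Proof.
move=> [b h]; rewrite /history_adj orbb eqxx /=.
by apply/negP=> /history_rel_suffix; rewrite ltnn andbF.
Qed.

Definition history_graph (n : nat) (C : finType) : sgraph :=
  SGraph (@history_adj_sym n C) (@history_adj_irr n C).

Lemma history_graph_triangle_free (n : nat) (C : finType) :
  triangle_free (history_graph n C).
Proof.
move=> [[b f] [[b' g] [[b'' h]]]]; rewrite /= /history_adj /=.
case=> /andP[/eqP<- fg] /andP[/eqP<- gh] /andP[_ fh]; move: fg gh fh.
have tri := @history_rel_triangle_free n C b.
have cyc (u v w : seq C) :
  history_rel n b u v -> history_rel n b v w -> history_rel n b w u -> False.
  move=> /history_rel_suffix/andP[_ uv] /history_rel_suffix/andP[_ vw].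
  move=> /history_rel_suffix/andP[_ /(ltn_trans (ltn_trans uv vw))].
  by rewrite ltnn.
(* Two of the eight orientations are cyclic, which lengths exclude; in the other six the longest
   history has the other two as earlier neighbours. *)
case/orP=> fg /orP[] gh /orP[] fh;
  try by [apply: cyc fg gh fh | apply: cyc fh gh fg].
- by move: (tri _ _ _ fh gh); rewrite fg.
- by move: (tri _ _ _ fg gh); rewrite fh.
- by move: (tri _ _ _ gh fg); rewrite fh.
- by move: (tri _ _ _ gh fh); rewrite fg.
- by move: (tri _ _ _ fg fh); rewrite gh.
- by move: (tri _ _ _ fh fg); rewrite gh.
Qed.

Lemma insub_bseqK (n : nat) (T : Type) (s : seq T) :
  size s <= n -> insub_bseq n s = s :> seq T.
Proof. by move=> le_sn; rewrite /insub_bseq insubdK. Qed.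

(** The forest is the tree of histories in each copy: a parent forgets the most recent colour, and
    the length, from 0 to [n], serves as rank. *)
Lemma history_graph_treedepth_le (n : nat) (C : finType) :
  treedepth (history_graph n C) <= n.+1.
Proof.
pose p : {ffun history_graph n C -> option (history_graph n C)} :=
  [ffun x : bool * {bseq n of C} =>
     if (x.2 : seq C) is _ :: g then Some (x.1, insub_bseq n g) else None].
have up (b : bool) (s : seq C) : forall g h : {bseq n of C},
    h = s ++ g :> seq C -> connect (parent_rel p) (b, h) (b, g).
  elim: s => [|c s IHs] g h hE; first by rewrite (val_inj hE) connect0.
  have le_n : size (s ++ g) <= n by have := size_bseq h; rewrite hE => /ltnW.
  rewrite connect_parentE ffunE /= hE.
  by apply/orP; right; apply: IHs; apply: insub_bseqK.
pose r (x : history_graph n C) := size (x : bool * {bseq n of C}).2.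
apply: (@treedepth_le _ p r) => [[b h] [b' g]|[b h]|].
- rewrite /r ffunE /=; case: h => -[|c h] //= le_n [_ <-].
  by rewrite insub_bseqK // ltnW.
- exact: size_bseq.
have sub (b : bool) (g h : {bseq n of C}) :
    history_rel n b g h -> connect (parent_rel p) (b, h) (b, g).
  by case/history_rel_suffix/andP=> /suffixP[s hE] _; apply: up hE.
move=> [b g] [b' h] /andP[/= /eqP<- /orP[]] /sub -> //.
by rewrite orbT.
Qed.

(** In the [true] copy every degree is at least [n]: a leaf sees its [n] proper suffixes, and any
    other history sees at least [#|C|] leaves below it. *)
Lemma history_graph_treedepth_gt (n : nat) (C : finType) :
  n <= #|C| -> n < treedepth (history_graph n C).
Proof.
move=> le_nC.
pose S : {set history_graph n C} := [set x : bool * {bseq n of C} | x.1].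
have S0 : (true, insub_bseq n [::] : {bseq n of C}) \in S by rewrite inE.
apply: treedepth_gt_min_degree S0 _ => -[b h]; rewrite inE /= => ->.
have := size_bseq h; rewrite leq_eqVlt => /orP[/eqP hn | lt_hn].
  pose F (i : 'I_n) : history_graph n C := (true, insub_bseq n (drop i.+1 h)).
  have sz (i : 'I_n) : size (drop i.+1 h) = n - i.+1 by rewrite size_drop hn.
  have le_n (i : 'I_n) : size (drop i.+1 h) <= n by rewrite sz leq_subr.
  have Finj : injective F.
    move=> i j [/(congr1 (size \o val))] /=; rewrite !insub_bseqK // !sz => e.
    by apply/val_inj/succn_inj; rewrite -(subKn (ltn_ord i)) e subKn.
  rewrite -[n in n <= _]card_ord -(card_imset _ Finj).
  apply/subset_leq_card/subsetP=> _ /imsetP[i _ ->].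
  rewrite !inE /= /history_adj /= insub_bseqK // sz hn eqxx andbT.
  have n_gt0 := leq_ltn_trans (leq0n i) (ltn_ord i).
  by rewrite suffix_drop ltn_subrL n_gt0 orbT.
(* Padding with copies of [c] up to length [n] reaches a leaf; at least one copy is added, so
   distinct colours give distinct leaves. *)
pose F (c : C) : history_graph n C :=
  (true, insub_bseq n (nseq (n - size h) c ++ h)).
have sz (c : C) : size (nseq (n - size h) c ++ h) = n.
  by rewrite size_cat size_nseq subnK // ltnW.
have Finj : injective F.
  move=> c d [/(congr1 val)] /=; rewrite !insub_bseqK ?sz //.
  move/(congr1 (head c)).
  by rewrite -(subnSK lt_hn).
apply: leq_trans le_nC _; rewrite -(card_imset _ Finj).
apply/subset_leq_card/subsetP=> _ /imsetP[c _ ->].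
rewrite !inE /= /history_adj /= insub_bseqK ?sz // lt_hn eqxx.
by rewrite suffix_suffix.
Qed.

(** A colouring with [m < k] colours, embedded into [C], is a painter's strategy on the [false]
    copy, against which the presenter forces [k] colours. *)
Lemma history_graph_chromatic (n k : nat) (C : finType) :
  n.+1 = 'C(k.+1, 2) -> k <= #|C| ->
  k <= chromatic_number (history_graph n C).
Proof.
move=> nE le_kC; rewrite /chromatic_number.
case: ex_minnP => m /existsP[c /forallP c_proper] _; rewrite leqNgt.
apply/negP=> lt_mk; have le_mC : m <= #|C| := leq_trans (ltnW lt_mk) le_kC.
(* Histories longer than [n] get a default vertex; this is harmless, as the game asks for properness
   only up to length [n]. *)
pose v (h : seq C) : history_graph n C := (false, insub_bseq n h).
have [|s [le_ks]] :=
    @game_rel_colors C (fun h => enum_val (widen_ord le_mC (c (v h)))) k.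
  move=> g h; rewrite -nE ltnS => le_hn gh.
  have /andP[_ /ltnW lt_gh] := game_rel_suffix gh.
  apply/eqP=> /enum_val_inj/(congr1 val)/= /val_inj e.
  have /forallP/(_ (v h))/implyP := c_proper (v g).
  rewrite e eqxx => /(_ _)/negP[] //.
  rewrite /= /history_adj /= !insub_bseqK ?gh //; exact: leq_trans lt_gh le_hn.
rewrite (map_comp (fun i => enum_val (widen_ord le_mC i)) (fun h => c (v h))).
move/map_uniq/card_uniqP; rewrite size_map => sE.
by have := max_card [in [seq c (v h) | h <- s]]; rewrite sE card_ord leqNgt
  (leq_trans lt_mk le_ks).
Qed.

Theorem theorem10 (k : nat) (hk : 1 <= k) :
  exists G : sgraph,
    [/\ triangle_free G,
        treedepth G = 'C(k.+1, 2) &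
        k <= chromatic_number G].
Proof.
have d_gt0 : 0 < 'C(k.+1, 2) by rewrite bin_gt0.
have [n dE] : exists n, 'C(k.+1, 2) = n.+1.
  by exists 'C(k.+1, 2).-1; rewrite prednK.
have le_kn : k <= n.+1 by rewrite -dE binS bin1 leq_addl.
(* The alphabet needs [n] letters for the treedepth and [k] for the colouring; [n.+1] covers
   both. *)
exists (history_graph n 'I_n.+1); split.
- exact: history_graph_triangle_free.
- apply/eqP; rewrite dE eqn_leq history_graph_treedepth_le.
  by apply: history_graph_treedepth_gt; rewrite card_ord.
- by apply: history_graph_chromatic; rewrite ?card_ord.
Qed.
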